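(* Let $i\ge-1$, $n\ge1$ and $0\le r\le n+i$. Then the map $C\mapsto\widehat C(r)$ is a bijection from $\mathcal C_i(n)$ to $\{\widetilde C\in\mathcal C_i(n+1)\mid \widetilde C\text{ has an }(r+1)^+\text{-full-set}\}$.
   Context: Young diagrams use English notation: rows indexed $1,2,\dots$ top to bottom, columns $1,2,\dots$ left to right, $(x,y)$ the box in row $x$, column $y$, row lengths $\lambda_1\ge\lambda_2\ge\cdots$, $\lambda_j=0$ beyond the last row, $\lambda_0=+\infty$. $\delta_m=(m,\dots,1)$ ($m\ge1$), $\delta_m=\emptyset$ ($m\le0$); $[m]=\{1,\dots,m\}$. For $d\ge1$, $h_Y(d)=\min\{h\ge1:\lambda_{d-h}\ge\lambda_d+h\}$ is the height of the prime path of row $d$. If $B$ is the last box of row $x_B$, the $B$-strip is the set of last boxes of rows $x_B-h_Y(x_B)+1,\dots,x_B$; $B$ is a corner box if it is also lowest in its column. $Y'\gtrdot Y$ if $Y'$ is $Y$ with the $B$-strip of some corner box $B$ deleted. $\mathcal T_n$ is the set of Young diagrams contained in $\delta_{n-1}$ with the order generated by $\gtrdot$. A tableau $T$ fills a Young diagram with positive integers, rows strictly increasing left to right, columns weakly increasing downward, label set exactly $[l]$, $l=l(T)$; $T(x,y)$ denotes a label; $r$-set = boxes labelled $r$; $T^{(r)}$ = boxes with labels $\le r$; the end-box of a set of boxes is its box in the row of largest index. A $\psi$-tableau is a tableau with $sh(T^{(r-1)})\gtrdot sh(T^{(r)})$ for all $r\in[l(T)]$. For a $\psi$-tableau $C$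 of shape $\delta_{n-1}$ (outer diagonal $\{(k,n-k):k\in[n-1]\}$): the $r$-set is a full-set if it contains a box of row 1 and its end-box is an outer-diagonal box $(k,n-k)$; it is an $r^+$-full-set (plus-full-set) if moreover $k=n-1$, or $k\le n-2$ and $C(k+1,n-k-1)<r$. $\mathcal C_i(n)$ = $\psi$-tableaux of shape $\delta_{n-1}$ and length $n+i$. For $d\ge1$ and a tableau $T$, $\alpha_d(T)$ is obtained by moving every row of index $>d$ down one row and placing a copy of row $d$ in row $d+1$. For a tableau $Y$ of length $r$, $\beta_d(Y)$ is obtained by appending a box labelled $r+1$ at the end of each of rows $1,\dots,d$. For $C\in\mathcal C_i(n)$ and $0\le r\le n+i$: if some $k\in[n-1]$ has $C(k,n-k)\le r$, let $d$ be the least such $k$, otherwise $d=n$. Then $\widehat C(r)$ is obtained from $\beta_d(\alpha_d(C^{(r)}))$ by adding, for each box $(x,y)$ of $C$ with $C(x,y)>r$, the box $(x,y+1)$ labelled $C(x,y)+1$ if $x<d$, and the box $(x+1,y)$ labelled $C(x,y)+1$ if $x>d$ (row $d$ of $C$ has no label exceeding $r$). *)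

(* Defs.v *)
From mathcomp Require Import all_boot all_order all_algebra.
From mathcomp Require Import classical_sets functions.

Set Implicit Arguments.
Unset Strict Implicit.
Unset Printing Implicit Defensive.

Import Order.TTheory GRing.Theory Num.Theory.

(* A Young diagram is its list of row lengths; a tableau is its list of rows,
   each row being its list of labels.  Rows, columns and boxes (x, y) are
   numbered from 1. *)
Definition diagram := seq nat.
Definition tableau := seq (seq nat).
Definition box := (nat * nat)%type.

Definition is_diagram (Y : diagram) : bool := sorted geq Y && (0 \notin Y).

Definition row_len (Y : diagram) (x : nat) : nat := nth 0 Y x.-1.

Definition in_diagram (Y : diagram) (b : box) : bool :=
  (0 < b.1) && (0 < b.2 <= row_len Y b.1).

Definition delta (m : nat) : diagram := rev (iota 1 m).

(* lambda_x >= m, with the convention lambda_0 = +oo *)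
Definition row_len_ge (Y : diagram) (x m : nat) : bool :=
  (x == 0) || (m <= row_len Y x).

(* Subtraction is truncated, but h = d always qualifies (lambda_0 = +oo),
   hence the values h > d do not affect the minimum. *)
Definition prime_path_at (Y : diagram) (d h : nat) : bool :=
  (0 < h) && row_len_ge Y (d - h) (row_len Y d + h).

Lemma prime_path_ex (Y : diagram) (d : nat) : exists h, prime_path_at Y d h.
Proof. by exists d.+1; rewrite /prime_path_at /row_len_ge subnS subnn. Qed.

Definition prime_height (Y : diagram) (d : nat) : nat :=
  ex_minn (prime_path_ex Y d).

Definition last_box (Y : diagram) (b : box) : bool :=
  in_diagram Y b && (b.2 == row_len Y b.1).

Definition corner_box (Y : diagram) (b : box) : Prop :=
  last_box Y b /\ (forall x, in_diagram Y (x, b.2) -> x <= b.1).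

Definition in_strip (Y : diagram) (B b : box) : bool :=
  last_box Y b && (B.1 - prime_height Y B.1 < b.1 <= B.1).

Definition covers (Y' Y : diagram) : Prop :=
  [/\ is_diagram Y', is_diagram Y &
      exists B, corner_box Y B /\
        forall b, in_diagram Y' b = in_diagram Y b && ~~ in_strip Y B b].

Definition shape (T : tableau) : diagram := map size T.

Definition row (T : tableau) (x : nat) : seq nat := nth [::] T x.-1.

Definition label (T : tableau) (x y : nat) : nat := nth 0 (row T x) y.-1.

Definition tab_length (T : tableau) : nat := \max_(c <- flatten T) c.

Definition is_tableau (T : tableau) : Prop :=
  [/\ is_diagram (shape T),
      forall c, (c \in flatten T) = (0 < c <= tab_length T),
      forall x y y', in_diagram (shape T) (x, y) ->
        in_diagram (shape T) (x, y') -> y < y' -> label T x y < label T x y' &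
      forall x x' y, in_diagram (shape T) (x, y) ->
        in_diagram (shape T) (x', y) -> x <= x' -> label T x y <= label T x' y].

(* The tableau with rows f 1, ..., f m, where empty rows do not count. *)
Definition of_rows (m : nat) (f : nat -> seq nat) : tableau :=
  [seq s <- [seq f x | x <- iota 1 m] | s != [::]].

(* T^(r); in a tableau, the labels <= r of a row are its first ones *)
Definition restrict (T : tableau) (r : nat) : tableau :=
  of_rows (size T) (fun x => [seq c <- row T x | c <= r]).

Definition psi_tableau (T : tableau) : Prop :=
  is_tableau T /\
  forall r, 0 < r <= tab_length T ->
    covers (shape (restrict T r.-1)) (shape (restrict T r)).

Definition in_rset (T : tableau) (r : nat) (b : box) : bool :=
  in_diagram (shape T) b && (label T b.1 b.2 == r).

Definition end_box (T : tableau) (r : nat) (b : box) : Prop :=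
  in_rset T r b /\ forall b', in_rset T r b' -> b'.1 <= b.1.

(* The r-set of C, of shape delta n.-1, is a full-set with end-box (k, n-k). *)
Definition full_set_at (n : nat) (C : tableau) (r k : nat) : Prop :=
  [/\ 0 < k <= n.-1, exists y, in_rset C r (1, y) & end_box C r (k, n - k)].

Definition has_plus_full_set (n : nat) (C : tableau) (r : nat) : Prop :=
  exists k, full_set_at n C r k /\
    (k = n.-1 \/ (k <= n - 2 /\ label C k.+1 (n - k - 1) < r)).

Definition calC (i : int) (n : nat) : set tableau :=
  [set C | [/\ psi_tableau C, shape C = delta n.-1 &
               ((tab_length C)%:Z = n%:Z + i)%R]]%classic.

(* Row d + 1 of the result is the copy of row d of T. *)
Definition alpha (d : nat) (T : tableau) : tableau :=
  of_rows (size T).+1 (fun x => if x <= d then row T x else row T x.-1).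

(* Rows beyond the last one are empty, so that for d > size Y rows
   size Y + 1, ..., d of the result consist of the new box. *)
Definition beta (d : nat) (Y : tableau) : tableau :=
  of_rows (maxn d (size Y))
    (fun x => if x <= d then rcons (row Y x) (tab_length Y).+1 else row Y x).

(* The least k in [n-1] with C(k, n-k) <= r; find returns the length n-1 of the
   list, hence hat_row is n, if there is none. *)
Definition hat_row (n : nat) (C : tableau) (r : nat) : nat :=
  (find (fun k => label C k (n - k) <= r) (iota 1 n.-1)).+1.

(* The boxes labelled > r end the rows of C.  In row x < d of
   beta d (alpha d C^(r)) their predecessors are followed by the new box
   labelled r + 1, so appending them moves (x, y) to (x, y+1); for x > d the row
   x + 1 of beta d (alpha d C^(r)) consists of their predecessors only, so
   appending them moves (x, y) to (x+1, y). *)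
Definition hat (n r : nat) (C : tableau) : tableau :=
  let d := hat_row n C r in
  let Y := beta d (alpha d (restrict C r)) in
  let added (x : nat) : seq nat := [seq c.+1 | c <- row C x & r < c] in
  of_rows (maxn (size Y) (size C).+1)
    (fun x => row Y x ++
       (if x < d then added x else if d < x.-1 then added x.-1 else [::])).

(* Main.v *)
Require Import Defs.
From mathcomp Require Import all_boot all_order all_algebra.
From mathcomp Require Import classical_sets functions.
From mathcomp Require Import zify.
(* [row] and [shape] are shadowed by their namesakes in matrix and seq. *)
Import Defs.

Set Implicit Arguments.
Unset Strict Implicit.
Unset Printing Implicit Defensive.

(* A psi-tableau is the chain of its shapes.  Let f s x be the length of row x
   at time s, and F s x = f s x + x.  In a diagram, the strip of the corner box
   of row b consists of the rows p+1, ..., b, where p < b is the largest index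
   with F p >= F b (or 0).  The tableau hat n r C corresponds to the chain which
   duplicates row d up to time r, then adds a box to rows 1, ..., d, and then
   follows the old chain.  As row d is at time r the first one of maximal F, it
   is a strict left-to-right maximum of F at time r, and hence, going backwards,
   at all earlier times; so every strip through row d starts in row 1 and remains
   a strip when row d is duplicated.  After time r row d is full and is met by
   no strip.  Conversely, the plus condition says that rows d and d+1 are equal
   at time r; they are then equal at all earlier times, and row d+1 can be
   removed. *)

(** * Chains of row lengths *)

(* [covers] in terms of row lengths, with strip p+1, ..., b; only the values at
   positive arguments matter. *)
Definition fcovers (u v : nat -> nat) : Prop :=
  exists p b, [/\ p < b, v b.+1 < v b, p = 0 \/ v b + b <= v p + p,
    forall x, p < x < b -> v x + x < v b + b &
    forall x, 0 < x -> v x = u x + (p < x <= b)].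

(** The truncated [n - x] covers the rows of the staircase and the empty rows below it. That the
    intermediate functions are antitone is not imposed; it follows backwards from time [l]. *)
Definition chain (n l : nat) (f : nat -> nat -> nat) : Prop :=
  [/\ forall x, 0 < x -> f 0 x = 0,
      forall s, s < l -> fcovers (f s) (f s.+1) &
      forall x, 0 < x -> f l x = n - x].

Lemma eq_fcovers u v u' v' :
  (forall x, 0 < x -> u x = u' x) -> (forall x, 0 < x -> v x = v' x) ->
  fcovers u v -> fcovers u' v'.
Proof.
move=> uu vv [p [b [pb cb blk between uv]]]; exists p, b.
have vb := vv b; have vb1 := vv b.+1; have vp := vv p.
split=> //; rewrite -?vb -?vb1; try lia.
- by move=> x xp; rewrite -vv; [apply: between|]; lia.
- by move=> x x0; rewrite -vv // -uu // uv.
Qed.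

(** Deleting the strip shortens row [x] but not row [x.+1] only for [x = b], where [v b.+1 < v b]
    leaves room. *)
Lemma fcovers_antitone u v : fcovers u v ->
  (forall x, 0 < x -> v x.+1 <= v x) -> forall x, 0 < x -> u x.+1 <= u x.
Proof.
move=> [p [b [pb cb _ _ uv]]] va x x0.
have := uv x x0; have := uv x.+1 isT; have := va x x0.
have [->|xb] := eqVneq x b; first lia.
lia.
Qed.

Lemma fcovers_le u v x : fcovers u v -> 0 < x -> u x <= v x.
Proof. by move=> [p [b [_ _ _ _ uv]]] /uv ->; apply: leq_addr. Qed.

Lemma chain_antitone n l f s x :
  chain n l f -> s <= l -> 0 < x -> f s x.+1 <= f s x.
Proof.
move=> [_ fc fl] sl.
have [k def_l] : exists k, l = s + k by exists (l - s); lia.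
elim: k s sl def_l x => [|k IHk] s sl def_l x x0.
  have -> : s = l by lia.
  by rewrite !fl //; lia.
apply: (fcovers_antitone (fc s _)) => //; first lia.
by move=> y y0; apply: IHk => //; lia.
Qed.

Lemma chain_mono n l f s t x :
  chain n l f -> s <= t -> t <= l -> 0 < x -> f s x <= f t x.
Proof.
move=> [_ fc _] st tl x0.
elim: t st tl => [|t IHt] st tl; first by have -> : s = 0 by lia.
have [->//|s'] := eqVneq s t.+1.
by apply: leq_trans (IHt _ _) (fcovers_le (fc t _) x0); lia.
Qed.

Lemma chain_bound n l f s x :
  chain n l f -> s <= l -> 0 < x -> f s x <= n - x.
Proof.
move=> fch sl x0; have [_ _ fl] := fch.
by rewrite -fl //; apply: chain_mono fch _ _ _.
Qed.

(* Otherwise some x < d has u x + x >= u d + d; then a strip that raises row d but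
   not row x starts right below a row p, x <= p < d, with v p + p >= v d + d. *)
Lemma record_step d u v : fcovers u v -> 0 < d ->
  (forall x, 0 < x < d -> v x + x < v d + d) ->
  forall x, 0 < x < d -> u x + x < u d + d.
Proof.
move=> [p [b [pb cb blk between uv]]] d0 rec x xd.
have := rec x xd; have := uv x; have := uv d d0.
have [dp|pd] := leqP d p; first lia.
have [bd|db] := ltnP b d; first lia.
have vdb : v d + d <= v b + b.
  by have [->//|dNb] := eqVneq d b; have := between d; lia.
have [p0|blk'] := blk; first lia.
have [p0|p0] := posnP p; first lia.
have := rec p; lia.
Qed.

Lemma chain_record n l f r d : chain n l f -> r <= l -> 0 < d ->
  (forall x, 0 < x < d -> f r x + x < f r d + d) ->
  forall s, s <= r -> forall x, 0 < x < d -> f s x + x < f s d + d.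
Proof.
move=> [_ fc _] rl d0 rec s sr.
have [k def_r] : exists k, r = s + k by exists (r - s); lia.
elim: k s sr def_r => [|k IHk] s sr def_r.
  by have -> : s = r by lia.
by apply: (record_step (fc s _)) => //; [lia|apply: IHk; lia].
Qed.

(** * Duplicating a row of a chain, and removing the copy *)

Definition hat_chain (d r : nat) (f : nat -> nat -> nat) (s x : nat) : nat :=
  if s <= r then f s (if x <= d then x else x.-1)
  else f s.-1 (if x <= d then x else x.-1) + (x <= d).

(** While [hat_chain] passes time [r] twice, its step [r.+1] being the inserted one, here row [d.+1]
    and time [r.+1] are skipped. *)
Definition unhat_chain (d r : nat) (g : nat -> nat -> nat) (s x : nat) : nat :=
  if s <= r then g s (if x <= d then x else x.+1)
  else g s.+1 (if x <= d then x else x.+1) - (x <= d).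

(** The chain form of the choice made by [hat_row]. For [d = n] fullness means length 0, which is
    the default case. *)
Definition first_full (n r d : nat) (f : nat -> nat -> nat) : Prop :=
  [/\ 0 < d <= n, f r d = n - d & forall x, 0 < x < d -> f r x < n - x].

(** The chain form of a plus-full-set for the label [r.+1] in the staircase of [n.+1], with end-box
    in row [d]: the strip is rows 1 to [d], and row [d.+1] is already full. *)
Definition plus_full (n r d : nat) (f : nat -> nat -> nat) : Prop :=
  [/\ 0 < d <= n, f r.+1 d = n.+1 - d, f r d.+1 = n - d &
      forall x, 0 < x -> f r.+1 x = f r x + (x <= d)].

(** Let [F x = v x + x]. A strip ending above row [d] is unchanged and one starting below it moves
    down by one row. A strip through row [d] has [p = 0], since a row [p < d] with
    [F p >= F b >= F d] would contradict the maximality of row [d]; it is extended by the copy. *)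
Lemma fcovers_hat_low d u v : 0 < d ->
  (forall x, 0 < x < d -> v x + x < v d + d) -> fcovers u v ->
  fcovers (fun x => u (if x <= d then x else x.-1))
          (fun x => v (if x <= d then x else x.-1)).
Proof.
move=> d0 rec [p [b [pb cb blk between uv]]].
have [bd|db] := ltnP b d.
  exists p, b; split=> //.
  - by rewrite bd (ltnW bd).
  - have -> : b <= d by lia.
    by have -> : p <= d by lia.
  - move=> x xpb; have -> : b <= d by lia.
    have -> : x <= d by lia.
    by apply: between.
  - move=> x x0; case: ifP => xd; first exact: uv.
    by rewrite uv; lia.
have [pd|pd] := ltnP p d.
  have vdb : v d + d <= v b + b.
    by have [->//|dNb] := eqVneq d b; have := between d; lia.
  have p0 : p = 0 by have := rec p; lia.
  exists 0, b.+1; split=> //; last 1 first.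
  - by move=> x x0; case: ifP => xd; rewrite uv; lia.
  - by rewrite !ifN //; lia.
  - by left.
  move=> x xb; rewrite [b.+1 <= d]leqNgt ltnS db /=; case: ifP => xd.
    have [->|xNb] := eqVneq x b; first lia.
    by have := between x; lia.
  by have := between x.-1; lia.
exists p.+1, b.+1; split=> //; last 1 first.
- by move=> x x0; case: ifP => xd; rewrite uv; lia.
- by rewrite !ifN //; lia.
- by right; rewrite !ifN /=; lia.
by move=> x xb; rewrite !ifN /=; try lia; have := between x.-1; lia.
Qed.

(** Row [d] does not grow, so the strip lies entirely above or entirely below it. The rows up to [d]
    gain a box and the lower ones gain 1 in their index, so every [v x + x] rises by 1 and all
    comparisons persist. *)
Lemma fcovers_hat_high n d u v : 0 < d ->
  (forall x, 0 < x -> v x <= n - x) -> u d = n - d -> v d = n - d -> d <= n ->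
  fcovers u v ->
  fcovers (fun x => u (if x <= d then x else x.-1) + (x <= d))
          (fun x => v (if x <= d then x else x.-1) + (x <= d)).
Proof.
move=> d0 vn ud vd dn [p [b [pb cb blk between uv]]].
have := uv d d0; rewrite ud vd => dNs.
have [bd|db] := ltnP b d.
  exists p, b; split=> //.
  - by rewrite bd (ltnW bd); lia.
  - have -> : b <= d by lia.
    have -> : p <= d by lia.
    lia.
  - move=> x xpb; have -> : b <= d by lia.
    have -> : x <= d by lia.
    by have := between x; lia.
  - move=> x x0; case: ifP => xd; first by rewrite uv //; lia.
    by rewrite uv; lia.
have pd : d <= p by lia.
exists p.+1, b.+1; split=> //; last 1 first.
- by move=> x x0; case: ifP => xd; rewrite uv; lia.
- by rewrite !ifN //=; lia.
- by right; rewrite !ifN /=; lia.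
by move=> x xb; rewrite !ifN /=; try lia; have := between x.-1; lia.
Qed.

(** The copy just below row [d] makes the new box of row [d] a corner, and no row above is full, so
    the strip runs up to row 1. *)
Lemma fcovers_hat_mid n d u : 0 < d <= n -> u d = n - d ->
  (forall x, 0 < x < d -> u x < n - x) ->
  fcovers (fun x => u (if x <= d then x else x.-1))
          (fun x => u (if x <= d then x else x.-1) + (x <= d)).
Proof.
move=> /andP[d0 dn] ud rec; exists 0, d; split=> //.
- by rewrite leqnn ltnn /=; lia.
- by left.
- by move=> x xd; have := rec x; rewrite leqnn ud; case: ifP; lia.
- by move=> x ->.
Qed.

Lemma chain_hat n l r d f : chain n l f -> r <= l -> first_full n r d f ->
  chain n.+1 l.+1 (hat_chain d r f).
Proof.
move=> fch rl [dn fd rec]; have [f0 fc fl] := fch.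
have d0 : 0 < d by lia.
(* As [f r d + d = n], the first full row is a strict left-to-right maximum. *)
have recF : forall x, 0 < x < d -> f r x + x < f r d + d.
  by move=> x xd; have := rec x xd; lia.
have fd' s : r <= s -> s <= l -> f s d = n - d.
  move=> rs sl; apply/eqP; rewrite eqn_leq (chain_bound fch) //= -fd.
  exact: chain_mono fch _ _ _.
split.
- by move=> x x0; rewrite /hat_chain /=; case: ifP => xd; rewrite f0 //; lia.
- move=> s sl; rewrite /hat_chain.
  have [sr|rs|->] := ltngtP s r; rewrite /=.
  + have sr' : s < l by lia.
    by apply: fcovers_hat_low => //; [apply: (chain_record fch rl d0 recF)|exact: fc].
  + apply: (fcovers_hat_high (n := n)) => //; rewrite ?fd' //; try lia.
      by move=> x x0; apply: chain_bound fch _ _.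
    by case: s sl rs => // s sl rs; apply: fc.
  + by apply: (fcovers_hat_mid (n := n)).
- move=> x x0; rewrite /hat_chain ifN /=; last lia.
  by case: ifP => xd; rewrite fl; lia.
Qed.

Lemma plus_full_hat n l r d f : chain n l f -> r <= l -> first_full n r d f ->
  plus_full n r d (hat_chain d r f).
Proof.
move=> fch rl [dn fd rec]; rewrite /plus_full /hat_chain ltnn leqnn.
by rewrite leqnn /= ltnn fd; split=> //; lia.
Qed.

(* A strip turning u d > u d.+1 into v d = v d.+1 would start in row d+1, which
   requires v d + d >= v d.+1 + d.+1. *)
Lemma twin_step d u v : fcovers u v -> 0 < d ->
  u d.+1 <= u d -> v d = v d.+1 -> u d = u d.+1.
Proof.
move=> [p [b [pb cb blk between uv]]] d0 ua vdd.
have := uv d d0; have := uv d.+1 isT.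
have [pd|] := eqVneq p d; last by have [db|] := eqVneq b d; [subst b|]; lia.
by have [db|] := eqVneq d.+1 b; [subst b p; lia|subst p; have := between d.+1; lia].
Qed.

Lemma chain_twin n l f r d : chain n l f -> r <= l -> 0 < d ->
  f r d = f r d.+1 -> forall s, s <= r -> f s d = f s d.+1.
Proof.
move=> fch rl d0 rec s sr.
have [k def_r] : exists k, r = s + k by exists (r - s); lia.
elim: k s sr def_r => [|k IHk] s sr def_r.
  by have -> : s = r by lia.
have [_ fc _] := fch.
apply: (twin_step (fc s _)) => //; [lia| |apply: IHk; lia].
by apply: chain_antitone fch _ _ => //; lia.
Qed.

(** Rows [d] and [d.+1] agree before and after the step, so the strip contains both or neither: [b]
    and [p] differ from [d]. The three cases of [fcovers_hat_low] can then be reversed. *)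
Lemma fcovers_unhat_low d u v : 0 < d -> v d = v d.+1 -> u d = u d.+1 ->
  (forall x, 0 < x < d -> v x + x < v d + d) -> fcovers u v ->
  fcovers (fun x => u (if x <= d then x else x.+1))
          (fun x => v (if x <= d then x else x.+1)).
Proof.
move=> d0 vdd udd rec [p [b [pb cb blk between uv]]].
have bNd : b != d by apply/eqP => bd; rewrite bd in cb; lia.
have := uv d d0; have := uv d.+1 isT => uvd1 uvd.
have pNd : p != d by lia.
have [bd|db] := ltnP b d.
  exists p, b; split=> //.
  - by rewrite bd (ltnW bd).
  - have -> : b <= d by lia.
    by have -> : p <= d by lia.
  - move=> x xpb; have -> : b <= d by lia.
    have -> : x <= d by lia.
    by apply: between.
  - move=> x x0; case: ifP => xd; first exact: uv.
    by rewrite uv; lia.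
case: b => [|b] in pb cb blk between uv bNd db uvd uvd1 *; first lia.
(* Since rows [d] and [d.+1] agree, [x = d] may be read with the shifted index too. *)
have vF x : d <= x -> v (if x <= d then x else x.+1) = v x.+1.
  by move=> dx; case: ifP => // xd; have -> : x = d by lia.
have [p0|p0] := posnP p.
  exists 0, b; split=> //; rewrite ?vF; try lia.
  - have vdb : v d.+1 + d.+1 <= v b.+1 + b.+1.
      by have [->//|dNb] := eqVneq d b; have := between d.+1; lia.
    move=> x xb; case: ifP => xd; last by have := between x.+1; lia.
    have [xE|xNd] := eqVneq x d; last by have := rec x; lia.
    by subst x; have := between d.+1; lia.
  - by move=> x x0; case: ifP => xd; rewrite uv; lia.
have pd : d < p.
  have [//|pd] := ltnP d p.
  have vdb : v d + d <= v b.+1 + b.+1 by have := between d; lia.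
  by have := rec p; lia.
case: p => [|p] in pb blk between uv pNd p0 pd uvd uvd1 *; first lia.
exists p, b; split=> //; rewrite ?vF; try lia.
- by move=> x xb; rewrite vF; last lia; have := between x.+1; lia.
- by move=> x x0; case: ifP => xd; rewrite uv; lia.
Qed.

(** The strip avoids rows [d] and [d.+1], and every [v x + x] drops by 1. Positivity keeps the
    truncated subtraction exact. *)
Lemma fcovers_unhat_high d u v : 0 < d ->
  (forall x, 0 < x <= d -> 0 < u x) ->
  u d = v d -> u d.+1 = v d.+1 -> v d = (v d.+1).+1 ->
  fcovers u v ->
  fcovers (fun x => u (if x <= d then x else x.+1) - (x <= d))
          (fun x => v (if x <= d then x else x.+1) - (x <= d)).
Proof.
move=> d0 up ud ud1 vdd [p [b [pb cb blk between uv]]].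
have vp x : 0 < x <= d -> 0 < v x.
  by move=> xd; have := up x xd; rewrite (uv x); lia.
have := uv d d0; have := uv d.+1 isT => uvd1 uvd.
have [bd|db] := ltnP b d.
  exists p, b; split=> //.
  - by rewrite bd (ltnW bd); have := vp b; have := vp b.+1; lia.
  - have -> : b <= d by lia.
    have -> : p <= d by lia.
    by have := vp b; have := vp p; lia.
  - move=> x xpb; have -> : b <= d by lia.
    have -> : x <= d by lia.
    by have := between x; have := vp x; have := vp b; lia.
  - move=> x x0; case: ifP => xd; first by have := up x; rewrite uv //; lia.
    by rewrite uv; lia.
have vF x : d <= x -> v (if x <= d then x else x.+1) - (x <= d) = v x.+1.
  move=> dx; case: ifP => xd; last lia.
  have -> : x = d by lia.
  lia.
have dp : d < p by lia.
case: b => [|b] in pb cb blk between uv db uvd uvd1 *; first lia.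
case: p => [|p] in pb blk between uv dp uvd uvd1 *; first lia.
exists p, b; split=> //; rewrite ?vF; try lia.
- by move=> x xb; rewrite vF; last lia; have := between x.+1; lia.
- by move=> x x0; case: ifP => xd; rewrite uv; lia.
Qed.

(** Step [r.+1] has strip 1 to [d], which makes row [d] a strict maximum at time [r]. Row [d.+1] is
    not in it, so both rows have length [n - d] at time [r]; afterwards both stay at the staircase
    bound. *)
Lemma unhat_facts n l r d g : chain n.+1 l.+1 g -> r <= l -> plus_full n r d g ->
  [/\ forall x, 0 < x < d -> g r x + x < g r d + d,
      g r d = n - d,
      forall s, s <= r -> g s d = g s d.+1 &
      forall s, r < s <= l.+1 -> g s d = n.+1 - d /\ g s d.+1 = n - d].
Proof.
move=> gch rl [dn gd gd1 gx]; have [g0 gc gl] := gch.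
have d0 : 0 < d by lia.
have grd : g r d = n - d by have := gx d d0; rewrite leqnn gd; lia.
split=> //; last 1 first.
- move=> s rs.
  have := chain_mono (s := r.+1) (t := s) (x := d) gch; rewrite gd.
  have := chain_mono (s := r) (t := s) (x := d.+1) gch; rewrite gd1.
  have := chain_bound (s := s) (x := d) gch.
  by have := chain_bound (s := s) (x := d.+1) gch; lia.
- move=> x xd; have [p [b [pb cb _ between guv]]] := gc r rl.
  have bd : b = d.
    have := guv d d0; have := guv d.+1 isT; have := guv b.
    by have := gx d d0; have := gx d.+1 isT; have := gx b; lia.
  have p0 : p = 0 by have := guv 1; have := gx 1; lia.
  by have := between x; have := gx x; have := gx d; rewrite bd; lia.
- by move=> s sr; apply: (chain_twin gch) sr => //; [lia|rewrite gd1].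
Qed.

Lemma chain_unhat n l r d g : chain n.+1 l.+1 g -> r <= l -> plus_full n r d g ->
  chain n l (unhat_chain d r g).
Proof.
move=> gch rl gp; have [rec grd twin full] := unhat_facts gch rl gp.
have [dn gd gd1 gx] := gp; have [g0 gc gl] := gch.
have d0 : 0 < d by lia.
have gpos s x : r < s <= l.+1 -> 0 < x <= d -> 0 < g s x.
  move=> rs xd; have := chain_mono (s := r.+1) (t := s) (x := x) gch.
  by rewrite gx; lia.
(* Both branches agree at [s = r], because step [r.+1] only adds a box to rows 1 to [d]; so the step
   from [r] needs no separate case. *)
have def_hi s x : r <= s <= l -> 0 < x ->
    unhat_chain d r g s x = g s.+1 (if x <= d then x else x.+1) - (x <= d).
  move=> rs x0; rewrite /unhat_chain; case: ifP => // sr.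
  have -> : s = r by lia.
  by rewrite gx; case: ifP; lia.
split.
- by move=> x x0; rewrite /unhat_chain /=; case: ifP => xd; rewrite g0.
- move=> s sl; have [sr|rs] := ltnP s r.
    rewrite /unhat_chain sr ltnW //; apply: fcovers_unhat_low => //.
    + by rewrite twin.
    + by rewrite twin // ltnW.
    + by apply: (chain_record gch _ d0 rec) => //; lia.
    + by apply: gc; lia.
  apply: eq_fcovers (fun x x0 => esym (def_hi _ _ _ x0))
    (fun x x0 => esym (def_hi _ _ _ x0)) _; try lia.
  have [f1 f2] : g s.+1 d = n.+1 - d /\ g s.+1 d.+1 = n - d by apply: full; lia.
  have [f3 f4] : g s.+2 d = n.+1 - d /\ g s.+2 d.+1 = n - d by apply: full; lia.
  apply: fcovers_unhat_high => //; try lia.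
    by move=> x xd; apply: gpos => //; lia.
  by apply: gc; lia.
- by move=> x x0; rewrite def_hi //; last lia; case: ifP => xd; rewrite gl; lia.
Qed.

Lemma first_full_unhat n l r d g :
  chain n.+1 l.+1 g -> r <= l -> plus_full n r d g ->
  first_full n r d (unhat_chain d r g).
Proof.
move=> gch rl gp; have [rec grd twin full] := unhat_facts gch rl gp.
have [dn gd gd1 gx] := gp.
split=> //; rewrite /unhat_chain ?leqnn // => x xd.
by have := rec x xd; case: ifP; lia.
Qed.

Lemma unhat_chainK n l r d g s x :
  chain n.+1 l.+1 g -> r <= l -> plus_full n r d g -> s <= l.+1 -> 0 < x ->
  hat_chain d r (unhat_chain d r g) s x = g s x.
Proof.
move=> gch rl gp; have [rec grd twin full] := unhat_facts gch rl gp.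
have [dn gd gd1 gx] := gp => sl x0.
rewrite /hat_chain /unhat_chain.
have [xd|dx] := leqP x d.
  rewrite !xd; case: (leqP s r) => // sr; case: s => [|s] in sl sr *; first lia.
  rewrite /=; case: ifP => sr'.
    have -> : s = r by lia.
    by rewrite gx // xd.
  have := chain_mono (s := r.+1) (t := s.+1) (x := x) gch; rewrite gx //; lia.
have -> : x.-1 <= d = (x == d.+1) by lia.
(* The removed row is recovered from row [d]: equal to it up to time [r], and one box shorter
   afterwards, when both are full. *)
have [->|xd1] := eqVneq x d.+1.
  case: (leqP s r) => [sr|rs]; first by rewrite /= twin.
  case: s => [|s] in sl rs *; first lia.
  have [f1 f2] : g s.+1 d = n.+1 - d /\ g s.+1 d.+1 = n - d by apply: full; lia.
  by rewrite /= f1 f2; case: ifP => sr'; [have -> : s = r by lia|]; lia.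
rewrite prednK //; case: (leqP s r) => // sr; case: s => [|s] in sl sr *; first lia.
rewrite /=; case: ifP => sr'; last lia.
have -> : s = r by lia.
by rewrite gx; lia.
Qed.

Lemma hat_chainK d r f s x : unhat_chain d r (hat_chain d r f) s x = f s x.
Proof.
rewrite /unhat_chain /hat_chain; case: (leqP s r) => sr.
  by case: (leqP x d) => xd; [rewrite xd|rewrite ltnNge ltnW].
rewrite ltnNge (ltnW sr) /=.
by case: (leqP x d) => xd; [rewrite xd addnK|rewrite ltnNge (ltnW xd) addn0 subn0].
Qed.

Lemma eq_unhat_chain d r g g' s x : (forall t y, 0 < y -> g t y = g' t y) ->
  0 < x -> unhat_chain d r g s x = unhat_chain d r g' s x.
Proof.
by move=> E x0; rewrite /unhat_chain; case: ifP => xd; rewrite !E //; case: ifP.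
Qed.

Lemma eq_chain n l f g : (forall s x, s <= l -> 0 < x -> f s x = g s x) ->
  chain n l f -> chain n l g.
Proof.
move=> E [f0 fc fl]; split.
- by move=> x x0; rewrite -E ?f0.
- by move=> s sl; apply: eq_fcovers (fc s sl) => x; apply: E; lia.
- by move=> x x0; rewrite -E ?fl.
Qed.

Lemma eq_first_full n r d f g : (forall x, 0 < x -> f r x = g r x) ->
  first_full n r d f -> first_full n r d g.
Proof.
move=> E [dn fd rec]; have d0 : 0 < d by lia.
by split; rewrite -?E // => x xd; rewrite -E ?rec //; lia.
Qed.

Lemma eq_plus_full n r d f g : (forall s x, 0 < x -> f s x = g s x) ->
  plus_full n r d f -> plus_full n r d g.
Proof.
move=> E [dn fd fd1 fx]; have d0 : 0 < d by lia.
by split; rewrite -?E // => x x0; rewrite -!E ?fx.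
Qed.

(** * Tableaux as chains *)

(** For a tableau, the length of row [x] of T^(s): the chain attached to [T]. *)
Definition cnt (T : tableau) (s x : nat) : nat :=
  count (fun c => c <= s) (row T x).

(** Diagrams have no zero row and tableaux no empty row, so the default value reveals the length and
    a comparison row by row suffices. *)
Lemma eq_nth_notin (T : eqType) (z : T) (s1 s2 : seq T) :
  z \notin s1 -> z \notin s2 -> (forall i, nth z s1 i = nth z s2 i) -> s1 = s2.
Proof.
move=> z1 z2 E; apply: (@eq_from_nth _ z) => [|i _]; last exact: E.
apply/eqP; rewrite eqn_leq; apply/andP; split; rewrite leqNgt; apply/negP => lt.
- by move: z1; rewrite -(nth_default z (leqnn (size s2))) -E mem_nth.
- by move: z2; rewrite -(nth_default z (leqnn (size s1))) E mem_nth.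
Qed.

Lemma row_default (T : tableau) x : size T < x -> row T x = [::].
Proof. by move=> Tx; rewrite /row nth_default //; lia. Qed.

Lemma row_len_shape (T : tableau) x : row_len (shape T) x = size (row T x).
Proof.
rewrite /row_len /row /shape; have [xT|Tx] := ltnP x.-1 (size T).
  by rewrite (nth_map [::]).
by rewrite !nth_default // size_map.
Qed.

Lemma mem_shape0 (T : tableau) : (0 \in shape T) = ([::] \in T).
Proof.
by elim: T => [//|w T IH]; rewrite /= !in_cons -IH; case: w.
Qed.

Lemma mem_flatten_row (T : tableau) (c : nat) :
  reflect (exists2 x, 0 < x & c \in row T x) (c \in flatten T).
Proof.
apply: (iffP flattenP) => [[w wT cw]|[x x0 cx]].
  by exists (index w T).+1; rewrite // /row nth_index.
have [xT|Tx] := leqP x (size T); last by rewrite row_default in cx.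
by exists (row T x) => //; apply: mem_nth; rewrite prednK.
Qed.

Lemma tab_length_eq (T : tableau) l :
  (forall c, c \in flatten T -> c <= l) -> (0 < l -> l \in flatten T) ->
  tab_length T = l.
Proof.
move=> Tl lT; apply/eqP; rewrite eqn_leq; apply/andP; split.
  by apply/bigmax_leqP_seq => c /Tl.
have [->//|l0] := posnP l.
exact: (@leq_bigmax_seq _ _ predT id _ (lT l0)).
Qed.

Lemma is_diagramP (Y : diagram) :
  reflect (0 \notin Y /\ forall x, 0 < x -> row_len Y x.+1 <= row_len Y x)
          (is_diagram Y).
Proof.
rewrite /is_diagram andbC; apply: (iffP andP) => -[Y0 Yd]; split=> //.
  case=> // x _; rewrite /row_len /=.
  have [xY|Yx] := ltnP x.+1 (size Y); last by rewrite nth_default.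
  exact: (sortedP 0 Yd).
by apply/(sortedP 0) => i _; apply: (Yd i.+1).
Qed.

Lemma antitone_le (f : nat -> nat) :
  (forall x, 0 < x -> f x.+1 <= f x) ->
  forall x y, 0 < x -> x <= y -> f y <= f x.
Proof.
move=> fa x y x0; elim: y => [|y IHy] xy; first lia.
have [<-//|xNy] := eqVneq x y.+1.
by apply: leq_trans (fa y _) (IHy _); lia.
Qed.

(** With [p = b - h], the least height becomes the largest [p < b] with
    [row_len Y p + p >= row_len Y b + b]; [p = 0] stands for the infinite row. *)
Lemma prime_height_eq (Y : diagram) p b : p < b ->
  p = 0 \/ row_len Y b + b <= row_len Y p + p ->
  (forall x, p < x < b -> row_len Y x + x < row_len Y b + b) ->
  prime_height Y b = b - p.
Proof.
move=> pb blk between; rewrite /prime_height; case: ex_minnP => h.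
rewrite /prime_path_at /row_len_ge => /andP[h0 hP] hmin.
apply/eqP; rewrite eqn_leq hmin /=; last first.
  by rewrite subKn; lia.
rewrite leqNgt; apply/negP => hp.
by have := between (b - h); lia.
Qed.

Lemma prime_height_blocks (Y : diagram) b : 0 < b ->
  let p := b - prime_height Y b in
  [/\ p < b, p = 0 \/ row_len Y b + b <= row_len Y p + p &
      forall x, p < x < b -> row_len Y x + x < row_len Y b + b].
Proof.
move=> b0; rewrite /prime_height; case: ex_minnP => h.
rewrite /prime_path_at /row_len_ge => /andP[h0 hP] hmin; split; first lia.
  lia.
move=> x xb; rewrite ltnNge; apply/negP => le.
by have := hmin (b - x); rewrite subKn; lia.
Qed.

Lemma coversP (Y' Y : diagram) : is_diagram Y' -> is_diagram Y ->
  (covers Y' Y <-> fcovers (row_len Y') (row_len Y)).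
Proof.
move=> dY' dY; have /is_diagramP[_ Yanti] := dY.
have Yle := antitone_le Yanti.
split=> [[_ _ [[b yb] [[/andP[/= bY /eqP yE] cor] strip]]]|].
  move: bY; rewrite /in_diagram /= => /andP[b0 yb0].
  have [pb blk between] := prime_height_blocks Y b0.
  exists (b - prime_height Y b), b; split=> //.
    rewrite ltnNge; apply/negP => le.
    by have := cor b.+1; rewrite /in_diagram /=; lia.
  move=> x x0; set p := b - _ in pb blk between *.
  have E y : (0 < y <= row_len Y' x) =
      (0 < y <= row_len Y x) && ~~ [&& 0 < y, y == row_len Y x & p < x <= b].
    have := strip (x, y).
    by rewrite /in_diagram /in_strip /last_box /in_diagram /= -/p x0; lia.
  (* The last box of the row in [Y], its predecessor and the last box in [Y'] determine the new
     length. Rows of the strip are nonempty, being at least as long as row [b]. *)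
  have := E (row_len Y x); have := E (row_len Y x).-1; have := E (row_len Y' x).
  have [xb|] := boolP (p < x <= b); last lia.
  by have := Yle x b; lia.
case=> [p [b [pb cb blk between uv]]]; split=> //.
exists (b, row_len Y b); split.
  split; first by rewrite /last_box /in_diagram /= eqxx; lia.
  move=> x; rewrite /in_diagram /= leqNgt => xY; apply/negP => bx.
  by have := Yle b.+1 x; lia.
case=> x y; rewrite /in_strip /last_box /in_diagram /=.
rewrite (prime_height_eq pb blk between) subKn; last exact: ltnW.
have [->//|x0] := posnP x.
rewrite uv //; have := Yle x b; rewrite !uv //; lia.
Qed.

(** Discarding empty rows shifts no other row when the empty ones come last. *)
Lemma row_of_rows m (f : nat -> seq nat) :
  (forall x, 0 < x -> f x = [::] -> f x.+1 = [::]) ->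
  (forall x, m < x -> f x = [::]) ->
  forall x, 0 < x -> row (of_rows m f) x = f x.
Proof.
move=> fnil fm; have gen k a : 0 < a -> (forall x, a + k <= x -> f x = [::]) ->
    forall i, nth [::] [seq s <- [seq f x | x <- iota a k] | s != [::]] i = f (a + i).
  elim: k a => [|k IHk] a a0 fak i.
    by rewrite nth_nil fak //; lia.
  have fa1 j : nth [::] [seq s <- [seq f x | x <- iota a.+1 k] | s != [::]] j =
      f (a.+1 + j).
    by apply: IHk => // x; rewrite addSnnS; apply: fak.
  rewrite /=; case: eqP => /= [fa|_]; last first.
    by case: i => [|i] /=; rewrite ?addn0 // fa1 addSnnS.
  have fz j : f (a + j) = [::].
    by elim: j => [|j IHj]; rewrite ?addn0 // addnS fnil //; lia.
  by rewrite fa1 fz addSnnS fz.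
by case=> // x _; rewrite /row gen // => y ym; apply: fm; lia.
Qed.

Lemma of_rows_nonempty m f : [::] \notin of_rows m f.
Proof. by rewrite mem_filter eqxx. Qed.

(** Only conditions on single rows; the column order and the presence of all labels come from the
    chain. *)
Definition regular (l : nat) (T : tableau) : Prop :=
  [/\ [::] \notin T, forall x, sorted ltn (row T x) &
      forall x (c : nat), c \in row T x -> 0 < c <= l].

Lemma nth_le_count w y c : sorted ltn w -> y < size w ->
  (nth 0 w y <= c) = (y < count (fun a => a <= c) w).
Proof.
elim: w y => [//|a w IHw] y /=; rewrite (path_sortedE ltn_trans) => /andP[aw sw].
have w0 : c < a -> count (fun a => a <= c) w = 0.
  move=> ca; apply/eqP; rewrite -leqn0 leqNgt -has_count; apply/hasPn => e ew.
  by rewrite -ltnNge (ltn_trans ca) // (allP aw).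
case: y => [_|y yw] /=; first by case: (leqP a c) => [//|/w0 ->].
rewrite IHw //; case: (leqP a c) => [//|/w0 ->]; lia.
Qed.

Lemma countS w s : uniq w ->
  count (fun c => c <= s.+1) w = count (fun c => c <= s) w + (s.+1 \in w).
Proof.
move=> /count_uniq_mem <-; elim: w => //= a w ->.
by rewrite leq_eqVlt ltnS eq_sym; case: eqP => [<-|_]; lia.
Qed.

Lemma ltn_sorted_uniq w : sorted ltn w -> uniq w.
Proof. exact: (sorted_uniq ltn_trans ltnn). Qed.

Lemma regular_cntS l T s x : regular l T ->
  cnt T s.+1 x = cnt T s x + (s.+1 \in row T x).
Proof. by move=> [_ Ts _]; rewrite /cnt countS // ltn_sorted_uniq. Qed.

Lemma regular_cnt0 l T x : regular l T -> cnt T 0 x = 0.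
Proof.
move=> [_ _ Tl]; apply/eqP; rewrite -leqn0 leqNgt -has_count; apply/hasPn => c.
by move=> /Tl; lia.
Qed.

Lemma regular_cnt_size l T s x : regular l T -> l <= s -> cnt T s x = size (row T x).
Proof.
move=> [_ _ Tl] ls; apply/eqP; rewrite -all_count; apply/allP => c /Tl; lia.
Qed.

(** The increments of [cnt] tell which labels a row contains, and an increasing row is determined by
    its set of labels. *)
Lemma regular_ext l T1 T2 : regular l T1 -> regular l T2 ->
  (forall s x, s <= l -> 0 < x -> cnt T1 s x = cnt T2 s x) -> T1 = T2.
Proof.
move=> R1 R2 E; have [N1 S1 L1] := R1; have [N2 S2 L2] := R2.
apply: eq_nth_notin N1 N2 _ => i.
apply: (irr_sorted_eq ltn_trans ltnn (S1 i.+1) (S2 i.+1)) => -[|c].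
  by apply/idP/idP => [/L1|/L2].
have [cl|lc] := ltnP c l; last by apply/idP/idP => [/L1|/L2]; lia.
have := E c i.+1 (ltnW cl) isT; have := E c.+1 i.+1 cl isT.
rewrite (regular_cntS _ _ R1) (regular_cntS _ _ R2) => + Ec.
by rewrite Ec => /addnI; case: (_ \in _); case: (_ \in _).
Qed.

Lemma row_restrict T r x : (forall x, 0 < x -> cnt T r x.+1 <= cnt T r x) ->
  0 < x -> row (restrict T r) x = [seq c <- row T x | c <= r].
Proof.
move=> Ta; apply: row_of_rows => [{}x x0 /(congr1 size)|{}x Tx]; last first.
  by rewrite row_default.
rewrite /= size_filter => E; apply/size0nil; rewrite size_filter.
by have := Ta x x0; rewrite /cnt E; lia.
Qed.

Lemma row_len_restrict T r x : (forall x, 0 < x -> cnt T r x.+1 <= cnt T r x) ->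
  0 < x -> row_len (shape (restrict T r)) x = cnt T r x.
Proof. by move=> Ta x0; rewrite row_len_shape row_restrict // size_filter. Qed.

Lemma is_diagram_restrict T r : (forall x, 0 < x -> cnt T r x.+1 <= cnt T r x) ->
  is_diagram (shape (restrict T r)).
Proof.
move=> Ta; apply/is_diagramP; split; first by rewrite mem_shape0 of_rows_nonempty.
by move=> x x0; rewrite !row_len_restrict //; apply: Ta.
Qed.

Lemma row_len_delta n x : 0 < x -> row_len (delta n.-1) x = n - x.
Proof.
move=> x0; rewrite /row_len /delta; have [xn|nx] := ltnP x.-1 n.-1.
  by rewrite nth_rev size_iota // nth_iota; lia.
by rewrite nth_default ?size_rev ?size_iota //; lia.
Qed.

Lemma delta_notin0 m : 0 \notin delta m.
Proof. by rewrite mem_rev mem_iota. Qed.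

Lemma labelE T x y : label T x y = nth 0 (row T x) y.-1.
Proof. by []. Qed.

Lemma label_le l T x y c : regular l T -> 0 < y <= size (row T x) ->
  (label T x y <= c) = (y <= cnt T c x).
Proof. by move=> [_ Ts _] yx; rewrite labelE nth_le_count // ?prednK //; lia. Qed.

Lemma tableau_regular T : is_tableau T -> regular (tab_length T) T.
Proof.
move=> [/is_diagramP[T0 _] Tl Trow _]; split; first by rewrite -mem_shape0.
(* Because of [x.-1], row 0 is read as row 1. *)
- suff T1 x : 0 < x -> sorted ltn (row T x).
    by case=> [|x]; [exact: (T1 1)|exact: T1].
  move=> x0; apply/(sortedP 0) => i ix.
  by apply: (Trow x i.+1 i.+2); rewrite // /in_diagram /= row_len_shape x0; lia.
- suff T1 x c : 0 < x -> c \in row T x -> 0 < c <= tab_length T.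
    by case=> [|x] c; [exact: (T1 1)|exact: T1].
  by move=> x0 cx; rewrite -Tl; apply/mem_flatten_row; exists x.
Qed.

(** The last box with label at most [r] in row [x.+1] has above it a box whose label is at most [r]
    as well. *)
Lemma tableau_cnt_antitone T r x : is_tableau T -> 0 < x -> cnt T r x.+1 <= cnt T r x.
Proof.
move=> TT x0; have R := tableau_regular TT; have [/is_diagramP[_ Td] _ _ Tcol] := TT.
set y := cnt T r x.+1; have [->//|y0] := posnP y.
have yx : y <= size (row T x.+1) by apply: count_size.
have := Td x x0; rewrite !row_len_shape => xx1.
rewrite -(label_le _ R); last lia.
apply: leq_trans (_ : label T x.+1 y <= r); last by rewrite (label_le _ R) //; lia.
by apply: Tcol => //; rewrite /in_diagram /= row_len_shape; lia.
Qed.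

Lemma psi_chain n C : psi_tableau C -> shape C = delta n.-1 ->
  regular (tab_length C) C /\ chain n (tab_length C) (cnt C).
Proof.
move=> [CT Ccov] Csh; have R := tableau_regular CT; split=> //.
have Ca r x : 0 < x -> cnt C r x.+1 <= cnt C r x by apply: tableau_cnt_antitone.
split.
- by move=> x _; apply: regular_cnt0 R.
- move=> s sl; have := Ccov s.+1; rewrite /= sl => /(_ isT).
  rewrite coversP; try by apply: is_diagram_restrict => x; apply: Ca.
  by apply: eq_fcovers => x x0; rewrite row_len_restrict // => y; apply: Ca.
- by move=> x x0; rewrite (regular_cnt_size _ R) // -row_len_shape Csh row_len_delta.
Qed.

(** A strip is never empty, so every label up to [l] occurs; columns increase weakly because the
    shape at each time is antitone. *)
Lemma chain_psi n l C : regular l C -> chain n l (cnt C) ->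
  [/\ psi_tableau C, shape C = delta n.-1 & tab_length C = l].
Proof.
move=> R Cch; have [C0 Cs Cl] := R; have [_ fc fl] := Cch.
have Csz x : 0 < x -> size (row C x) = n - x.
  by move=> x0; rewrite -fl // (regular_cnt_size _ R).
have Csh : shape C = delta n.-1.
  apply: (@eq_nth_notin _ 0); rewrite ?mem_shape0 ?delta_notin0 // => i.
  rewrite -[LHS]/(row_len _ i.+1) -[RHS]/(row_len _ i.+1).
  by rewrite row_len_shape row_len_delta // Csz.
have mem c : (c \in flatten C) = (0 < c <= l).
  apply/mem_flatten_row/idP => [[x x0 /Cl //]|].
  case: c => // c /= cl; have [p [b [pb _ _ _ uv]]] := fc c cl.
  exists b; first lia.
  by have := uv b; rewrite (regular_cntS _ _ R); case: (_ \in _) => //; lia.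
have Clen : tab_length C = l.
  by apply: tab_length_eq => [c|l0]; rewrite mem ?l0 //= => /andP[].
split=> //; split; last first.
  rewrite Clen => s sl.
  have Ca t : t <= l -> forall x, 0 < x -> cnt C t x.+1 <= cnt C t x.
    by move=> tl x; apply: chain_antitone Cch tl.
  have d1 : is_diagram (shape (restrict C s)) by apply/is_diagram_restrict/Ca; lia.
  have d2 : is_diagram (shape (restrict C s.-1)) by apply/is_diagram_restrict/Ca; lia.
  apply/(coversP d2 d1); have := fc s.-1; rewrite prednK; last lia.
  move=> fcs; apply: eq_fcovers (fcs _); last lia.
  - by move=> x x0; rewrite row_len_restrict //; apply: Ca; lia.
  - by move=> x x0; rewrite row_len_restrict //; apply: Ca; lia.
split.
- apply/is_diagramP; rewrite mem_shape0; split=> // x x0.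
  by rewrite !row_len_shape !Csz; lia.
- by rewrite Clen.
- move=> x y y'; rewrite /in_diagram /= !row_len_shape => xy xy' yy'.
  by apply: (sorted_ltn_nth ltn_trans) => //; rewrite ?inE; lia.
- move=> x x' y; rewrite /in_diagram /= !row_len_shape => xy xy' xx'.
  rewrite (label_le _ R); last lia.
  set c := label C x' y.
  have : y <= cnt C c x' by rewrite -(label_le _ R) // /c; lia.
  move=> /leq_trans; apply.
  have cl : c <= l.
    suff /Cl/andP[] : c \in row C x' by [].
    have yx : y.-1 < size (row C x') by lia.
    by rewrite /c labelE mem_nth.
  by apply: (antitone_le (f := cnt C c)) => //; [move=> z; apply: chain_antitone Cch cl|lia].
Qed.

Lemma calCP i n C : calC i n C <->
  exists l, [/\ (l%:Z = n%:Z + i)%R, regular l C & chain n l (cnt C)].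
Proof.
split=> [[Cp Csh Cl]|[l [li R Cch]]].
  by have [R Cch] := psi_chain Cp Csh; exists (tab_length C).
by have [Cp Csh Clen] := chain_psi R Cch; split; rewrite // Clen.
Qed.

(** * The tableau hat n r C *)

Definition tableau_of_chain (n l : nat) (f : nat -> nat -> nat) : tableau :=
  of_rows n (fun x => [seq s <- iota 1 l | f s.-1 x < f s x]).

(** Starting at 0 and rising by at most 1 at a time, [u] counts its own rises. *)
Lemma count_steps l (u : nat -> nat) s : u 0 = 0 ->
  (forall t, t < l -> u t <= u t.+1 <= (u t).+1) -> s <= l ->
  count (fun c => c <= s) [seq t <- iota 1 l | u t.-1 < u t] = u s.
Proof.
move=> u0; elim: l s => [|l IHl] s ul sl; first by have -> : s = 0 by lia.
rewrite -(addn1 l) iotaD filter_cat count_cat add1n /=.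
have {}IHl t : t <= l ->
    count (fun c => c <= t) [seq t <- iota 1 l | u t.-1 < u t] = u t.
  by apply: IHl => t' t'l; apply: ul; lia.
have [sl'|ls] := leqP s l.
  by rewrite IHl //; case: ifP => /=; lia.
have -> : s = l.+1 by lia.
rewrite -(_ : count (fun c => c <= l) [seq t <- iota 1 l | u t.-1 < u t] =
  count (fun c => c <= l.+1) [seq t <- iota 1 l | u t.-1 < u t]); last first.
  apply: eq_in_count => t; rewrite mem_filter mem_iota => /andP[_ tl].
  by rewrite (_ : t <= l) 1?(_ : t <= l.+1); lia.
rewrite IHl //; have := ul l (ltnSn l).
by case: ifP => /=; lia.
Qed.

Lemma tableau_of_chainP n l f : chain n l f ->
  regular l (tableau_of_chain n l f) /\
  forall s x, s <= l -> 0 < x -> cnt (tableau_of_chain n l f) s x = f s x.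
Proof.
move=> fch; have [f0 fc fl] := fch.
set w := fun x => [seq s <- iota 1 l | f s.-1 x < f s x].
have wcnt s x : s <= l -> 0 < x -> count (fun c => c <= s) (w x) = f s x.
  move=> sl x0; apply: (count_steps (u := f ^~ x)) => //; first exact: f0.
  by move=> t tl; have [p [b [_ _ _ _ uv]]] := fc t tl; rewrite uv //; lia.
have wl x c : c \in w x -> 0 < c <= l by rewrite mem_filter mem_iota; lia.
have wsz x : 0 < x -> size (w x) = n - x.
  move=> x0; rewrite -fl // -(wcnt l) //; apply/esym/eqP.
  by rewrite -all_count; apply/allP => c /wl; lia.
have rw x : 0 < x -> row (tableau_of_chain n l f) x = w x.
  apply: row_of_rows => {}x x0; last by apply/size0nil; rewrite wsz; lia.
  by move=> /(congr1 size) /=; rewrite wsz // => nx; apply/size0nil; rewrite wsz; lia.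
split; last by move=> s x sl x0; rewrite /cnt rw // wcnt.
split; first exact: of_rows_nonempty.
- suff S x : 0 < x -> sorted ltn (row (tableau_of_chain n l f) x).
    by case=> [|x]; [exact: (S 1)|exact: S].
  by move=> x0; rewrite rw //; apply: sorted_filter (iota_ltn_sorted _ _); apply: ltn_trans.
- suff L x c : 0 < x -> c \in row (tableau_of_chain n l f) x -> 0 < c <= l.
    by case=> [|x] c; [exact: (L 1)|exact: L].
  by move=> x0; rewrite rw //; apply: wl.
Qed.

Lemma first_full_inj n r d d' f :
  first_full n r d f -> first_full n r d' f -> d = d'.
Proof.
move=> [dn fd rec] [dn' fd' rec']; apply/eqP; rewrite eqn_leq.
by have := rec d'; have := rec' d; lia.
Qed.

Lemma first_full_hat_row n l r C : 0 < n -> regular l C -> chain n l (cnt C) ->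
  r <= l -> first_full n r (hat_row n C r) (cnt C).
Proof.
move=> n0 R Cch rl; rewrite /hat_row.
set P := fun k => label C k (n - k) <= r; set d := find P _.
have [_ _ Cl] := Cch.
have PE k : 0 < k < n -> P k = (cnt C r k == n - k).
  move=> kn; have k0 : 0 < k by lia.
  rewrite /P (label_le _ R); last first.
    by rewrite -(regular_cnt_size _ R (leqnn l)) Cl //; lia.
  by rewrite eqn_leq (chain_bound Cch).
have dn : d <= n.-1 by rewrite -(size_iota 1 n.-1); apply: find_size.
split; first lia.
(* If no row of index below [n] is full, the row chosen is [n], which is full with length 0. *)
- have [dn'|dn'] := ltnP d n.-1; last first.
    by have := chain_bound (x := d.+1) Cch rl isT; lia.
  have /(nth_find 0) : has P (iota 1 n.-1) by rewrite has_find size_iota.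
  by rewrite nth_iota // add1n PE; [move/eqP|lia].
- move=> x xd; have := before_find 0 (_ : x.-1 < d).
  rewrite nth_iota ?add1n ?prednK ?PE; try lia.
  by have := chain_bound (x := x) Cch rl; lia.
Qed.

(** Raising the labels above [r] to make room for [r.+1] delays the later times by one, whence the
    two cases of [hat_chain]. *)
Lemma count_hat_row r s e w :
  count (fun c => c <= s)
    ([seq c <- w | c <= r] ++ nseq (e : bool) r.+1 ++ [seq c.+1 | c <- w & r < c]) =
  if s <= r then count (fun c => c <= s) w
  else count (fun c => c <= s.-1) w + e.
Proof.
rewrite !count_cat count_filter count_map count_filter count_nseq.
case: (leqP s r) => sr.
  by elim: w => [|a w] /=; lia.
by rewrite mul1n; elim: w => [|a w] /=; lia.
Qed.

Section HatRows.
Variables (n l r : nat) (C : tableau).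
Hypotheses (n0 : 0 < n) (R : regular l C) (Cch : chain n l (cnt C)) (rl : r <= l).
Let d := hat_row n C r.
(** The row of [C] from which row [x] of the new tableau comes; [d] and [d.+1] both come from
    [d]. *)
Let bump x := if x <= d then x else x.-1.

Let row_size x : 0 < x -> size (row C x) = n - x.
Proof. by have [_ _ Cl] := Cch; move=> x0; rewrite -Cl // (regular_cnt_size _ R). Qed.

Let first_d : first_full n r d (cnt C).
Proof. exact: first_full_hat_row n0 R Cch rl. Qed.

Let d0 : 0 < d.
Proof. by []. Qed.

Let row_d : [seq c <- row C d | r < c] = [::].
Proof.
have [dn fd _] := first_d; apply/eqP; rewrite -(negbK (_ == _)) -has_filter.
apply/hasPn => c cd; rewrite -leqNgt.
have /allP : all (fun c => c <= r) (row C d); last by apply.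
by rewrite all_count row_size; [apply/eqP|lia].
Qed.

Let row_R x : 0 < x -> row (restrict C r) x = [seq c <- row C x | c <= r].
Proof. by apply: row_restrict => y; apply: chain_antitone Cch rl. Qed.

Let R_nil x : 0 < x -> row (restrict C r) x = [::] -> row (restrict C r) x.+1 = [::].
Proof.
move=> x0; rewrite !row_R // => /(congr1 size) /= E; apply/size0nil.
have := chain_antitone Cch rl x0; rewrite /cnt -!size_filter E; lia.
Qed.

Let row_alpha x : 0 < x ->
  row (alpha d (restrict C r)) x = [seq c <- row C (bump x) | c <= r].
Proof.
move=> x0; rewrite row_of_rows // /bump.
- by case: ifP => xd; rewrite row_R //; have := d0; lia.
- move=> {x0}x x0; case: ifP => xd xnil; case: ifP => xd1 //; try lia.
  + exact: R_nil.
  + by case: x x0 xd xd1 xnil => // x _ ? ?; apply: R_nil; lia.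
- by move=> y yR; rewrite !row_default ?if_same //; lia.
Qed.

(** This makes [r.+1] the label appended by [beta]. The label [r] occurs because the strip of step
    [r] is nonempty. *)
Let tab_length_alpha : tab_length (alpha d (restrict C r)) = r.
Proof.
apply: tab_length_eq => [c /mem_flatten_row[x x0]|r0].
  by rewrite row_alpha // mem_filter => /andP[].
have [_ fc _] := Cch; have [p [b [pb _ _ _ uv]]] : fcovers (cnt C r.-1) (cnt C r).
  by have := fc r.-1; rewrite prednK //; apply.
have rb : r \in row C b.
  have := uv b; rewrite -{1}(prednK r0) (regular_cntS _ _ R) prednK //.
  by case: (_ \in _) => //; lia.
apply/mem_flatten_row; exists (if b <= d then b else b.+1); first by case: ifP; lia.
rewrite row_alpha /bump; last by case: ifP; lia.
rewrite mem_filter leqnn /=; case: (leqP b d) => bd; first by rewrite bd.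
by rewrite leqNgt ltnS (ltnW bd).
Qed.

Let row_beta x : 0 < x ->
  row (beta d (alpha d (restrict C r))) x =
  [seq c <- row C (bump x) | c <= r] ++ nseq (x <= d) r.+1.
Proof.
move=> x0; rewrite row_of_rows // tab_length_alpha.
- by case: ifP => xd; rewrite row_alpha // -?cats1 ?cats0.
- move=> {x0}x x0; case: ifP => [_|xd]; first by case: (row _ _).
  rewrite ifN; last lia.
  rewrite !row_alpha // /bump !ifN; try lia.
  move=> xnil; rewrite -row_R //= -(prednK (_ : 0 < x)) //.
  by apply: R_nil; rewrite ?row_R //; lia.
- by move=> y yd; rewrite ifN ?row_default //; lia.
Qed.

Lemma row_hat x : 0 < x ->
  row (hat n r C) x = [seq c <- row C (bump x) | c <= r] ++ nseq (x <= d) r.+1 ++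
    [seq c.+1 | c <- row C (bump x) & r < c].
Proof.
have [dn fd _] := first_d.
set w := fun x => [seq c <- row C (bump x) | c <= r] ++ nseq (x <= d) r.+1 ++
    [seq c.+1 | c <- row C (bump x) & r < c].
(* These are the lengths of the next staircase, so the empty rows come last, as [row_of_rows]
   requires. *)
have wsz y : 0 < y -> size (w y) = n.+1 - y.
  move=> y0; rewrite !size_cat size_map size_nseq !size_filter.
  have -> : count (fun c => c <= r) (row C (bump y)) +
      ((y <= d) + count (fun c => r < c) (row C (bump y))) =
      size (row C (bump y)) + (y <= d).
    by elim: (row C (bump y)) => [|a t] /=; lia.
  by rewrite row_size /bump; case: ifP; lia.
pose h y := row (beta d (alpha d (restrict C r))) y ++
  (if y < d then [seq c.+1 | c <- row C y & r < c]
   else if d < y.-1 then [seq c.+1 | c <- row C y.-1 & r < c] else [::]).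
have hw y : 0 < y -> h y = w y.
  move=> y0; rewrite /h row_beta // -catA /w /bump.
  have [yd|dy|->] := ltngtP y d => //.
    by have [yd1|dy1|<-] := ltngtP d y.-1; rewrite ?row_d //; lia.
  by rewrite ifN ?row_d //; lia.
move=> x0; rewrite -[RHS]/(w x) -hw //; apply: (row_of_rows (f := h)) x0 => y y0.
  rewrite !hw // => /(congr1 size) /=; rewrite wsz // => ny.
  by apply/size0nil; rewrite wsz //; lia.
move: y0; rewrite gtn_max => /andP[yY yC].
by rewrite /h (row_default yY) !(row_default (T := C)) ?if_same //; lia.
Qed.

Lemma cnt_hat s x : 0 < x -> cnt (hat n r C) s x = hat_chain d r (cnt C) s x.
Proof. by move=> x0; rewrite /cnt row_hat // count_hat_row. Qed.

Lemma regular_hat : regular l.+1 (hat n r C).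
Proof.
have [_ Cs Cl] := R; split; first exact: of_rows_nonempty.
- suff S x : 0 < x -> sorted ltn (row (hat n r C) x).
    by case=> [|x]; [exact: (S 1)|exact: S].
  (* As a pairwise relation the order splits over the three pieces, with labels at most [r], equal
     to [r.+1], and above [r.+1]. *)
  move=> x0; rewrite row_hat // sorted_pairwise; last exact: ltn_trans.
  have := Cs (bump x); rewrite sorted_pairwise; last exact: ltn_trans.
  move=> Cp; rewrite !pairwise_cat !pairwise_filter // pairwise_map.
  rewrite (@pairwise_filter _ (relpre S ltn)) //.
  rewrite (_ : pairwise ltn (nseq _ _)) ?andbT; last by case: (_ <= _).
  apply/andP; split; apply/allrelP => a b.
    rewrite mem_filter mem_cat => /andP[ar _] /orP[/nseqP[-> //]|].
    by move=> /mapP[c + ->]; rewrite mem_filter; lia.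
  by move=> /nseqP[-> _] /mapP[c + ->]; rewrite mem_filter; lia.
- suff L x c : 0 < x -> c \in row (hat n r C) x -> 0 < c <= l.+1.
    by case=> [|x] c; [exact: (L 1)|exact: L].
  move=> x0; rewrite row_hat // !mem_cat mem_filter => /or3P[/andP[_ /Cl]||].
  + lia.
  + by move=> /nseqP[-> _]; lia.
  + by move=> /mapP[e + ->]; rewrite mem_filter => /andP[_ /Cl]; lia.
Qed.

End HatRows.

(** * Plus-full-sets and the bijection *)

Lemma in_rsetE l C c x y : regular l C ->
  in_rset C c.+1 (x, y) = (0 < x) && (cnt C c x < y <= cnt C c.+1 x).
Proof.
move=> R; rewrite /in_rset /in_diagram /= row_len_shape -andbA; case: posnP => //= x0.
have := count_size (fun a => a <= c.+1) (row C x); rewrite -/(cnt C c.+1 x).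
have [yC|] := boolP (0 < y <= size (row C x)); last lia.
have := label_le c.+1 R yC; have := label_le c R yC; lia.
Qed.

(** A box in row 1 forces [p = 0] and the end-box forces [b = d]. The plus condition says that row
    [d.+1] is full by time [r]; for [d = n] its bound is 0. *)
Lemma has_plus_full_setP n l r C :
  regular l.+1 C -> chain n.+1 l.+1 (cnt C) -> r <= l ->
  has_plus_full_set n.+1 C r.+1 <-> exists d, plus_full n r d (cnt C).
Proof.
move=> R Cch rl; have [_ fc Cl] := Cch.
have Csz x : 0 < x -> size (row C x) = n.+1 - x.
  by move=> x0; rewrite -Cl // (regular_cnt_size _ R).
have bnd s x : s <= l.+1 -> 0 < x -> cnt C s x <= n.+1 - x.
  exact: chain_bound Cch.
have [p [b [pb _ _ _ uv]]] := fc r rl.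
split=> [[d [[/= dn [y y1] [dr dmax]] dplus]]|[d [dn fd fd1 fx]]].
  (* Row [b] ends with a box labelled [r.+1], so [b <= d]; the end-box itself lies in the strip, so
     [d <= b]. *)
  have bd := dmax (b, cnt C r.+1 b); have bound := bnd r.+1 d.
  move: y1 dr bd; rewrite !(in_rsetE _ _ _ R) /= => y1 dr bd.
  have uv1 := uv 1; have uvd := uv d; have uvb := uv b.
  have [p0 bE] : p = 0 /\ b = d by lia.
  exists d; split=> //; try lia.
  - have bound1 := bnd r d.+1; have [//|[dn' lab]] := dplus; first lia.
    have := label_le r R (_ : 0 < n.+1 - d - 1 <= size (row C d.+1)).
    by rewrite Csz //; lia.
  - by move=> x x0; rewrite uv // p0 bE x0.
exists d; split.
  split; first exact: dn.
  - by exists (cnt C r.+1 1); rewrite (in_rsetE _ _ _ R); have := fx 1; lia.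
  - split; first by rewrite (in_rsetE _ _ _ R); have := fx d; lia.
    by case=> x y; rewrite (in_rsetE _ _ _ R) /=; have := fx x; lia.
have [dn'|dn'] := eqVneq d n; [by left|right; split; first lia].
by rewrite ltnS (label_le _ R) ?Csz //; lia.
Qed.

Theorem theorem4p6 (i : int) (n r : nat)
  (hi : (-1 <= i)%R) (hn : 1 <= n) (hr : (r%:Z <= n%:Z + i)%R) :
  set_bij (calC i n)
    [set C' | calC i n.+1 C' /\ has_plus_full_set n.+1 C' r.+1]%classic
    (hat n r).
Proof.
have hatP C l : r <= l -> regular l C -> chain n l (cnt C) ->
    [/\ regular l.+1 (hat n r C), chain n.+1 l.+1 (cnt (hat n r C)) &
        plus_full n r (hat_row n C r) (cnt (hat n r C))].
  move=> rl R Cch; have Fd := first_full_hat_row hn R Cch rl.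
  have E s x : 0 < x -> hat_chain (hat_row n C r) r (cnt C) s x = cnt (hat n r C) s x.
    by move=> x0; rewrite (cnt_hat hn R Cch rl).
  split; first exact: regular_hat.
    exact: eq_chain (fun s x _ => E s x) (chain_hat Cch rl Fd).
  exact: eq_plus_full E (plus_full_hat Cch rl Fd).
split.
- move=> C /calCP[l [li R Cch]]; have rl : r <= l by lia.
  have [R' Cch' plus] := hatP C l rl R Cch.
  split; first by apply/calCP; exists l.+1; split=> //; lia.
  by apply/(has_plus_full_setP R' Cch' rl); exists (hat_row n C r).
- move=> C1 C2; rewrite !inE => /calCP[l [li R1 Cch1]] /calCP[l2 [l2i R2 Cch2]] E.
  have ll2 : l2 = l by lia.
  rewrite {}ll2 {l2i} in R2 Cch2; have rl : r <= l by lia.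
  have [_ Hch1 P1] := hatP C1 l rl R1 Cch1.
  have [_ Hch2 P2] := hatP C2 l rl R2 Cch2.
  (* The image determines [d]: the rows that grow at step [r.+1] are 1 to [d]. *)
  have dE : hat_row n C1 r = hat_row n C2 r.
    have [dn1 _ _ fx1] := P1; have [dn2 _ _ fx2] := P2; rewrite E in fx1.
    have := fx1 (hat_row n C1 r); have := fx2 (hat_row n C1 r).
    have := fx1 (hat_row n C2 r); have := fx2 (hat_row n C2 r); lia.
  apply: (regular_ext R1 R2) => s x sl x0.
  rewrite -(hat_chainK (hat_row n C1 r) r (cnt C1)).
  rewrite -[RHS](hat_chainK (hat_row n C1 r) r).
  apply: eq_unhat_chain => // t y y0.
  by rewrite -(cnt_hat hn R1 Cch1 rl) // E dE -(cnt_hat hn R2 Cch2 rl).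
- move=> C' [/calCP[l' [l'i R' Cch']] plus].
  (* The length of [C'] is [n + 1 + i], which is positive since [r <= n + i]. *)
  case: l' => [|l] in l'i R' Cch' *; first lia.
  have rl : r <= l by lia.
  have [d P'] := (has_plus_full_setP R' Cch' rl).1 plus.
  have Uch := chain_unhat Cch' rl P'; have Fd := first_full_unhat Cch' rl P'.
  have [R cntE] := tableau_of_chainP Uch.
  set C := tableau_of_chain _ _ _ in R cntE.
  have cntE' s x : s <= l -> 0 < x -> unhat_chain d r (cnt C') s x = cnt C s x.
    by move=> sl x0; rewrite cntE.
  have Cch : chain n l (cnt C).
    exact: eq_chain cntE' Uch.
  exists C; first by apply/calCP; exists l; split=> //; lia.
  have [RH _ _] := hatP C l rl R Cch.
  (* The first full row is unique, so the hat map duplicates exactly the row whose copy was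
     removed. *)
  have dE : hat_row n C r = d.
    apply: first_full_inj (first_full_hat_row hn R Cch rl) _.
    exact: eq_first_full (fun x => cntE' r x rl) Fd.
  apply: (regular_ext RH R') => s x sl x0.
  rewrite (cnt_hat hn R Cch rl) // dE -(unhat_chainK Cch' rl P') //.
  have y0 : 0 < if x <= d then x else x.-1 by have [dn _ _ _] := P'; case: ifP; lia.
  by rewrite /hat_chain; case: ifP => sr; rewrite cntE //; lia.
Qed.
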